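(* For every $a \in \left(\frac{3}{2},2\right)$, let $x_a$ (with $0<x_a<\pi$) denote the unique zero in $(0,\pi)$ of the function $f_a(x) = a\ln\frac{\sin x}{x} - 2\ln\cos\frac{x}{2}$. Then for every $x \in (0,x_a]$ the following inequality holds: $$\left(\frac{\sin x}{x}\right)^{a} \;\leq\; \cos^{2}\frac{x}{2}.$$
   Context: For $a \in \left(\frac{3}{2},2\right)$ the function $f_a:(0,\pi)\to\mathbb{R}$, $f_a(x) = a\ln\frac{\sin x}{x} - 2\ln\cos\frac{x}{2}$, has exactly one zero in the interval $(0,\pi)$; this zero is denoted by $x_a$. *)

(* Defs.v *)
From Stdlib Require Import Reals.
Open Scope R_scope.

(* On (0, PI) both sin x / x and cos (x / 2) are positive, so Stdlib's total
   [ln] is the usual logarithm there; outside (0, PI) the value of [f] is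
   irrelevant, as [is_zero_f] below restricts to that interval. *)
Definition f (a x : R) : R := a * ln (sin x / x) - 2 * ln (cos (x / 2)).

Definition is_zero_f (a x : R) : Prop := 0 < x < PI /\ f a x = 0.

(* Main.v *)
Require Import Defs.
From Stdlib Require Import Reals.
From Stdlib Require Import Ranalysis5 Lra Psatz.
From Coquelicot Require Import Coquelicot.
Open Scope R_scope.

(** Put t = x/2 and g(t) = f_a(2t) = a ln (sin t / t) - (2 - a) ln cos t on
    (0, pi/2).  Then g'(t) = tan t ((2 - a) - a h(t)), where
    h(t) = cot t / t - cot^2 t is strictly decreasing: this is Wilker's
    inequality (sin t / t)^2 + tan t / t > 2, which follows by AM-GM from
    sin^3 t > t^3 cos t.  As g tends to 0 at 0, it follows that g(s) >= 0 forces
    a h(s) < 2 - a, so that g increases strictly from s on; hence g has at most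
    one zero, with g < 0 before it.  A zero exists because h tends to
    1/3 > (2 - a)/a at 0 and g tends to infinity at pi/2. *)

(** * Taylor bounds and Wilker's inequality *)

Lemma sin_ge_cubic (t : R) : 0 < t < PI / 2 -> t - t ^ 3 / 6 <= sin t.
Proof.
intros Ht.
destruct (pre_sin_bound t 0) as [H _]; [lra | pose proof PI_4; lra |].
unfold sin_approx, sin_term in H; simpl in H. lra.
Qed.

Lemma cos_quartic_bounds (t : R) : 0 < t < PI / 2 ->
  1 - t ^ 2 / 2 <= cos t <= 1 - t ^ 2 / 2 + t ^ 4 / 24.
Proof.
intros Ht. pose proof PI_4.
destruct (pre_cos_bound t 0) as [H1 H2]; [lra | lra |].
unfold cos_approx, cos_term in H1, H2; simpl in H1, H2. lra.
Qed.

Lemma sin_cube_gt (t : R) : 0 < t < PI / 2 -> t ^ 3 * cos t < sin t ^ 3.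
Proof.
intros Ht. pose proof PI_4.
pose proof (sin_ge_cubic t Ht) as Hs. pose proof (cos_quartic_bounds t Ht) as [_ Hc].
assert (Ht4 : t ^ 2 < 4) by nra.
assert (Hpow : (t * (1 - t ^ 2 / 6)) ^ 3 <= sin t ^ 3).
{ apply pow_incr; split; [apply Rmult_le_pos; lra | lra]. }
assert (H3 : 0 < t ^ 3) by (apply pow_lt; lra).
assert (H4 : 0 < t ^ 4) by (apply pow_lt; lra).
(* The Taylor bounds for sine and cosine reduce the claim to polynomials; the gap
   [t ^ 4 * (9 - t ^ 2) / 216] is positive because [t < 2]. *)
assert (Hpoly : 1 - t ^ 2 / 2 + t ^ 4 / 24 < (1 - t ^ 2 / 6) ^ 3).
{ replace ((1 - t ^ 2 / 6) ^ 3)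
    with (1 - t ^ 2 / 2 + t ^ 4 / 24 + t ^ 4 * (9 - t ^ 2) / 216) by field.
  assert (0 < t ^ 4 * (9 - t ^ 2)) by (apply Rmult_lt_0_compat; lra). lra. }
rewrite Rpow_mult_distr in Hpow.
apply Rlt_le_trans with (2 := Hpow), Rmult_lt_compat_l; lra.
Qed.

Lemma wilker (t : R) : 0 < t < PI / 2 ->
  2 * t ^ 2 * cos t < t * sin t + sin t ^ 2 * cos t.
Proof.
intros Ht.
pose proof (sin_cube_gt t Ht) as H3.
assert (Hs : 0 < sin t) by (apply sin_gt_0; lra).
assert (Hc : 0 < cos t) by (apply cos_gt_0; lra).
assert (Hp : 0 < t * cos t) by (apply Rmult_lt_0_compat; lra).
(* Squared AM-GM: the right side squared is at least [4 * t * sin t ^ 3 * cos t], which exceeds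
   [4 * t ^ 4 * cos t ^ 2]. *)
apply Rsqr_incrst_0.
- unfold Rsqr.
  assert (t * cos t * (t ^ 3 * cos t) < t * cos t * sin t ^ 3)
    by (apply Rmult_lt_compat_l; lra).
  pose proof (pow2_ge_0 (t * sin t - sin t ^ 2 * cos t)). lra.
- apply Rmult_le_pos; [nra | lra].
- apply Rplus_le_le_0_compat; apply Rmult_le_pos; try lra. apply pow2_ge_0.
Qed.

(** * Monotonicity of [h] and its behaviour near 0 *)

Definition h (t : R) : R := cos t / (t * sin t) - (cos t / sin t) ^ 2.

Lemma h_decreasing (s t : R) : 0 < s -> s < t -> t < PI / 2 -> h t < h s.
Proof.
intros Hs Hst Ht.
set (h' := fun u => (2 * u ^ 2 * cos u - (u * sin u + sin u ^ 2 * cos u))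
                    / (u ^ 2 * sin u ^ 3)).
destruct (MVT_cor2 h h' s t Hst) as [c [Hc Hcb]].
- intros u Hu. apply is_derive_Reals. unfold h, h'.
  assert (Hsu : 0 < sin u) by (apply sin_gt_0; lra).
  auto_derive.
  + repeat split; try lra. apply Rmult_integral_contrapositive; lra.
  + assert (Hsq : cos u * cos u = 1 - sin u * sin u)
      by (pose proof (sin2_cos2 u); unfold Rsqr in *; lra).
    field_simplify_eq; [| lra].
    replace (cos u ^ 3) with (cos u * (cos u * cos u)) by ring.
    replace (cos u ^ 2) with (cos u * cos u) by ring.
    rewrite Hsq. ring.
- assert (Hneg : h' c < 0).
  { assert (0 < sin c) by (apply sin_gt_0; lra).
    pose proof (wilker c ltac:(lra)).
    apply Rdiv_neg_pos; [lra |].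
    apply Rmult_lt_0_compat; apply pow_lt; lra. }
  nra.
Qed.

(** Write [h t] as [(sin t - t * cos t) * cos t / (t * sin t ^ 2)]: Taylor bounds control the
    numerator from below, and the denominator is at most [t ^ 3]. This is a quantitative form of the
    limit 1/3 at 0. *)
Lemma h_lower_bound (t : R) : 0 < t -> t <= 1 -> 1 / 3 - t ^ 2 / 4 < h t.
Proof.
intros Ht Ht1. pose proof PI2_1.
pose proof (sin_ge_cubic t ltac:(lra)) as Hsl.
pose proof (cos_quartic_bounds t ltac:(lra)) as [Hcl Hcu].
pose proof (sin_lt_x t Ht) as Hsu.
assert (Hs : 0 < sin t) by (apply sin_gt_0; lra).
assert (Hc : 0 < cos t) by (apply cos_gt_0; lra).
assert (H2 : 0 < t ^ 2 <= 1) by (split; [apply pow_lt; lra | nra]).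
assert (H3 : 0 < t ^ 3) by (apply pow_lt; lra).
assert (Hnum : t ^ 3 * (1 / 3 - t ^ 2 / 24) <= sin t - t * cos t).
{ assert (t * cos t <= t * (1 - t ^ 2 / 2 + t ^ 4 / 24))
    by (apply Rmult_le_compat_l; lra). lra. }
assert (Hprod : t ^ 3 * (1 / 3 - t ^ 2 / 4) < (sin t - t * cos t) * cos t).
{ apply Rlt_le_trans with (t ^ 3 * (1 / 3 - t ^ 2 / 24) * (1 - t ^ 2 / 2)).
  - rewrite Rmult_assoc. apply Rmult_lt_compat_l; nra.
  - apply Rmult_le_compat; try lra. apply Rmult_le_pos; lra. }
replace (h t) with ((sin t - t * cos t) * cos t / (t * sin t ^ 2))
  by (unfold h; field; lra).
assert (Hden : 0 < t * sin t ^ 2) by (apply Rmult_lt_0_compat; [lra | apply pow_lt; lra]).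
apply Rmult_lt_reg_r with (t * sin t ^ 2); [lra |].
replace ((sin t - t * cos t) * cos t / (t * sin t ^ 2) * (t * sin t ^ 2))
  with ((sin t - t * cos t) * cos t) by (field; lra).
apply Rle_lt_trans with (2 := Hprod).
rewrite (Rmult_comm _ (t * _)). apply Rmult_le_compat_r; [lra |].
replace (t ^ 3) with (t * t ^ 2) by ring.
apply Rmult_le_compat_l; [lra |]. apply pow_incr; lra.
Qed.

(** * Sign and monotonicity of [g] *)

Definition g (a t : R) : R := a * ln (sin t / t) - (2 - a) * ln (cos t).

Lemma f_double (a t : R) : 0 < t < PI / 2 -> Defs.f a (2 * t) = g a t.
Proof.
intros Ht. unfold Defs.f, g.
assert (Hs : 0 < sin t) by (apply sin_gt_0; lra).
assert (Hc : 0 < cos t) by (apply cos_gt_0; lra).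
replace (2 * t / 2) with t by field.
rewrite sin_2a.
replace (2 * sin t * cos t / (2 * t)) with (sin t / t * cos t) by (field; lra).
rewrite ln_mult; [ring | apply Rdiv_lt_0_compat; lra | lra].
Qed.

Lemma g_derive (a t : R) : 0 < t < PI / 2 ->
  derivable_pt_lim (g a) t (sin t / cos t * (2 - a - a * h t)).
Proof.
intros Ht. apply is_derive_Reals. unfold g, h.
assert (Hs : 0 < sin t) by (apply sin_gt_0; lra).
assert (Hc : 0 < cos t) by (apply cos_gt_0; lra).
auto_derive.
- repeat split; try lra. apply Rdiv_lt_0_compat; lra.
- field. lra.
Qed.

Lemma g_MVT (a s t : R) : 0 < s -> s < t -> t < PI / 2 ->
  exists c k, s < c < t /\ 0 < k /\ g a t - g a s = k * (2 - a - a * h c).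
Proof.
intros Hs Hst Ht.
destruct (MVT_cor2 (g a) (fun u => sin u / cos u * (2 - a - a * h u)) s t Hst)
  as [c [Hc Hcb]].
- intros u Hu. apply g_derive. lra.
- exists c, (sin c / cos c * (t - s)). repeat split; try lra.
  apply Rmult_lt_0_compat; [| lra].
  apply Rdiv_lt_0_compat; [apply sin_gt_0 | apply cos_gt_0]; lra.
Qed.

(** Only an upper bound is needed, so the negative term [a * ln (sin s / s)] is dropped; what
    remains is continuous and vanishes at 0. *)
Lemma g_small_near_0 (a e : R) : a < 2 -> 0 < a -> 0 < e ->
  exists d, 0 < d /\ forall s, 0 < s < d -> s < PI / 2 -> g a s < e.
Proof.
intros Ha2 Ha0 He.
assert (Hcont : continuity_pt (fun s => - (2 - a) * ln (cos s)) 0).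
{ apply derivable_continuous_pt. exists (- (2 - a) * (1 * - sin 0 * / cos 0)).
  apply is_derive_Reals. auto_derive; rewrite ?cos_0, ?sin_0; [lra | field]. }
destruct (Hcont e He) as [d [Hd Hd']].
exists d. split; [exact Hd |]. intros s Hs Hs2.
specialize (Hd' s). simpl in Hd'. unfold R_dist in Hd'.
rewrite cos_0, ln_1, Rmult_0_r, !Rminus_0_r in Hd'.
assert (Hlt : Rabs (- (2 - a) * ln (cos s)) < e).
{ apply Hd'. split; [| rewrite Rabs_pos_eq; lra].
  split; [exact I | lra]. }
apply Rabs_def2 in Hlt.
assert (Hsin : 0 < sin s) by (apply sin_gt_0; lra).
pose proof (sin_lt_x s ltac:(lra)).
assert (Hln : ln (sin s / s) < 0).
{ rewrite <- ln_1. apply ln_increasing; [apply Rdiv_lt_0_compat; lra |].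
  apply Rmult_lt_reg_r with s; [lra |].
  replace (sin s / s * s) with (sin s) by (field; lra). lra. }
unfold g. nra.
Qed.

Lemma h_small_of_g_nonneg (a s : R) : 0 < a < 2 -> 0 < s < PI / 2 ->
  0 <= g a s -> a * h s < 2 - a.
Proof.
intros Ha Hs Hg.
destruct (Rlt_le_dec (a * h s) (2 - a)) as [Hlt | Hle]; [exact Hlt | exfalso].
(* If [a * h s >= 2 - a], then g' < 0 on (0, s) since [h] decreases. Hence
   [g a (s / 2) > g a s >= 0], and [g] stays above this positive value towards 0, against
   [g_small_near_0]. *)
assert (Hdec : forall u v, 0 < u -> u < v -> v <= s -> g a v < g a u).
{ intros u v Hu Huv Hv.
  destruct (g_MVT a u v) as [c [k [Hc [Hk E]]]]; try lra.
  assert (a * h s < a * h c) by (apply Rmult_lt_compat_l, h_decreasing; lra).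
  nra. }
pose proof (Hdec (s / 2) s ltac:(lra) ltac:(lra) ltac:(lra)).
destruct (g_small_near_0 a (g a (s / 2))) as [d [Hd Hd']]; try lra.
set (u := Rmin (d / 2) (s / 4)).
assert (Hu : 0 < u <= d / 2 /\ u <= s / 4).
{ unfold u. split; [split |].
  - apply Rmin_pos; lra.
  - apply Rmin_l.
  - apply Rmin_r. }
pose proof (Hd' u ltac:(lra) ltac:(lra)).
pose proof (Hdec u (s / 2) ltac:(lra) ltac:(lra) ltac:(lra)). lra.
Qed.

Lemma g_increasing_of_nonneg (a s t : R) : 0 < a < 2 -> 0 < s -> s < t -> t < PI / 2 ->
  0 <= g a s -> g a s < g a t.
Proof.
intros Ha Hs Hst Ht Hg.
pose proof (h_small_of_g_nonneg a s Ha ltac:(lra) Hg).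
destruct (g_MVT a s t) as [c [k [Hc [Hk E]]]]; try lra.
assert (a * h c < a * h s) by (apply Rmult_lt_compat_l, h_decreasing; lra).
nra.
Qed.

(** * Existence of the zero and conclusion *)

Lemma g_neg_exists (a : R) : 3 / 2 < a < 2 -> exists t, 0 < t <= 1 / 3 /\ g a t < 0.
Proof.
intros Ha.
set (c := (2 - a) / a).
assert (Hac : a * c = 2 - a) by (unfold c; field; lra).
assert (Hc : 0 < c < 1 / 3) by nra.
(* The bound [c < 1 / 3] is exactly [a > 3 / 2]. For [t = 1 / 3 - c],
   [h t > 1 / 3 - t ^ 2 / 4 > 1 / 3 - t = c], so [a * h t > 2 - a], which excludes [g a t >= 0]. *)
exists (1 / 3 - c). split; [lra |].
destruct (Rlt_le_dec (g a (1 / 3 - c)) 0) as [Hlt | Hle]; [exact Hlt | exfalso].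
pose proof PI2_1.
pose proof (h_small_of_g_nonneg a (1 / 3 - c) ltac:(lra) ltac:(lra) Hle).
pose proof (h_lower_bound (1 / 3 - c) ltac:(lra) ltac:(lra)).
nra.
Qed.

Lemma g_pos_exists (a : R) : 3 / 2 < a < 2 ->
  exists t, 1 / 3 < t < PI / 2 /\ 0 < g a t.
Proof.
intros Ha. pose proof PI2_1. pose proof PI_4.
(* At [t = PI / 2 - d] with [d = exp (- M)], [cos t = sin d < d] makes the cosine term exceed
   [(2 - a) * M = a * ln 4], while [sin t / t > 1 / 4] keeps the other term above [- a * ln 4]. *)
set (M := a * ln 4 / (2 - a)).
assert (HM : (2 - a) * M = a * ln 4) by (unfold M; field; lra).
assert (Hl4 : 0 < ln 4) by (rewrite <- ln_1; apply ln_increasing; lra).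
assert (HM4 : ln 4 < M) by nra.
set (d := exp (- M)).
assert (Hd0 : 0 < d) by apply exp_pos.
assert (Hd : d < 1 / 4).
{ replace (1 / 4) with (exp (- ln 4)).
  - apply exp_increasing. lra.
  - rewrite exp_Ropp, exp_ln; lra. }
exists (PI / 2 - d). split; [lra |].
unfold g. rewrite sin_shift, cos_shift.
assert (Hsd : 0 < sin d) by (apply sin_gt_0; lra).
assert (Hln1 : ln (sin d) < - M).
{ replace (- M) with (ln d) by apply ln_exp.
  apply ln_increasing; [lra | apply sin_lt_x; lra]. }
pose proof (cos_quartic_bounds d ltac:(lra)) as [Hcl _].
assert (Hln2 : - ln 4 < ln (cos d / (PI / 2 - d))).
{ rewrite <- ln_Rinv by lra. apply ln_increasing; [lra |].
  apply Rmult_lt_reg_r with (PI / 2 - d); [lra |].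
  replace (cos d / (PI / 2 - d) * (PI / 2 - d)) with (cos d) by (field; lra).
  nra. }
nra.
Qed.

Theorem theorem6 :
  forall a : R, 3 / 2 < a < 2 ->
  exists xa : R,
    unique (is_zero_f a) xa /\
    forall x : R, 0 < x <= xa -> Rpower (sin x / x) a <= cos (x / 2) ^ 2.
Proof.
intros a Ha.
destruct (g_neg_exists a Ha) as [t0 [Ht0 Hg0]].
destruct (g_pos_exists a Ha) as [t1 [Ht1 Hg1]].
destruct (IVT_interv (g a) t0 t1) as [z [Hz Hgz]]; try lra.
{ intros u Hu. apply derivable_continuous_pt. eexists. apply g_derive. lra. }
exists (2 * z). split.
- split.
  + split; [lra |]. rewrite f_double by lra. exact Hgz.
  + intros y [Hy Hfy].
    replace y with (2 * (y / 2)) in Hfy by field.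
    rewrite f_double in Hfy by lra.
    destruct (Rtotal_order z (y / 2)) as [Hlt | [Heq | Hgt]]; [| lra |].
    * pose proof (g_increasing_of_nonneg a z (y / 2)). lra.
    * pose proof (g_increasing_of_nonneg a (y / 2) z). lra.
- intros x Hx.
  assert (Hc : 0 < cos (x / 2)) by (apply cos_gt_0; lra).
  assert (Hf : Defs.f a x <= 0).
  { replace x with (2 * (x / 2)) by field. rewrite f_double by lra.
    destruct (Rle_lt_dec (g a (x / 2)) 0) as [Hle | Hgt]; [exact Hle | exfalso].
    (* A positive value before [z] would force [g a z > 0]. *)
    destruct (Req_dec (x / 2) z) as [Heq | Hneq]; [rewrite Heq in Hgt; lra |].
    pose proof (g_increasing_of_nonneg a (x / 2) z). lra. }
  unfold Defs.f in Hf.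
  rewrite <- (exp_ln (cos (x / 2) ^ 2)) by (apply pow_lt; lra).
  rewrite ln_pow by lra. unfold Rpower. replace (INR 2) with 2 by (simpl; ring).
  destruct (Req_dec (a * ln (sin x / x)) (2 * ln (cos (x / 2)))) as [Heq | Hneq].
  + right. now rewrite Heq.
  + left. apply exp_increasing. lra.
Qed.
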